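(* Let $f=\sum_{i=0}^n a_ix^i\in\mathbb{Z}[x]$ with $n>0$, $a_n>0$, $a_0\neq0$ and $\gcd(a_0,\dots,a_n)=1$. Suppose $f$ has a unique positive root $x_+$ and every root $w$ of $f$ satisfies $|w|\leq x_+$. Suppose there exists a minimal integer $\delta>1$ such that, for all roots $z\neq x_+$ of $f$, $|z|=x_+$ implies $z^\delta\in\mathbb{R}_{>0}$. Let $f^*\in\mathbb{Z}[x]$ be the polynomial associated with $f$ and $\delta$ as in the context. Then $f^*(x)$ has only one root (which may be a multiple root) whose absolute value is $x_+^\delta$, and any root $z\neq x_+^\delta$ of $f^*$ satisfies $|z|<x_+^\delta$.
   Context: Definition of $f^*$ for a positive integer $\delta$: write $f=\prod_{j=1}^m q_j^{\alpha_j}$ with $\alpha_j\geq1$ and $q_j$ pairwise distinct primitive irreducible polynomials in $\mathbb{Z}[x]$ with positive leading coefficients. Let $q_j^*\in\mathbb{Z}[x]$, with positive leading coefficient, be such that $q_j^*(x^\delta)$ is (up to sign) the square-free part of the Sylvester resultant $R_u(u^\delta-x^\delta,q_j(u))$ with respect to $u$. Then $f^*=\mathrm{lcm}\{(q_j^* )^{\alpha_j}\mid j=1,\dots,m\}$ (with positive leading coefficient). It satisfies $(f)_{\mathbb{Z}[x]}\cap\mathbb{Z}[x^\delta]=(f^*(x^\delta))_{\mathbb{Z}[x^\delta]}$, where $(\cdot)_R$ denotes the ideal of $R$ generated by the given element. *)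

(* Defs.v *)
From HB Require Import structures.
From mathcomp Require Import all_boot all_order all_algebra.

Set Implicit Arguments.
Unset Strict Implicit.
Unset Printing Implicit Defensive.

Import Order.TTheory GRing.Theory Num.Theory.
Local Open Scope ring_scope.

(* Irreducibility of an element of the ring Z[x].  The library's
   [irreducible_poly] is stated with pseudo-division, i.e. it speaks about
   irreducibility over the field of fractions. *)
Definition zirreducible (p : {poly int}) : Prop :=
  [/\ p != 0, p \isn't a GRing.unit &
      forall a b : {poly int},
        p = a * b -> a \is a GRing.unit \/ b \is a GRing.unit].

(* Divisibility in the ring Z[x]; the library's [%|] on {poly int} is
   pseudo-divisibility, which ignores contents. *)
Definition zdvdp (p q : {poly int}) : Prop :=
  exists r : {poly int}, q = r * p.

Definition is_lcmp (I : finType) (F : I -> {poly int}) (g : {poly int}) : Prop :=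
  (forall i, zdvdp (F i) g) /\
  (forall h : {poly int}, (forall i, zdvdp (F i) h) -> zdvdp g h).

(* Since the units of Z[x] are 1 and -1, irreducibles with positive leading
   coefficient are associate only if they are equal.  Constant irreducibles
   (prime numbers) are allowed here. *)
Definition irreducible_family (m : nat) (q : 'I_m -> {poly int})
    (alpha : 'I_m -> nat) : Prop :=
  [/\ injective q,
      forall j, (1 <= alpha j)%N,
      forall j, zirreducible (q j) &
      forall j, 0 < lead_coef (q j)].

(* The product of the distinct irreducible factors of P, each to the power
   one. *)
Definition is_squarefree_part (P s : {poly int}) : Prop :=
  exists (m : nat) (p : 'I_m -> {poly int}) (e : 'I_m -> nat),
    [/\ irreducible_family p e,
        P = \prod_j p j ^+ e j \/ P = - \prod_j p j ^+ e j &
        s = \prod_j p j].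

(* R_u(u^delta - x^delta, q(u)): the outer variable of {poly {poly int}} is u,
   the inner one is x. *)
Definition resultant_u (delta : nat) (q : {poly int}) : {poly int} :=
  resultant ('X^delta - ('X^delta)%:P : {poly {poly int}}) (map_poly polyC q).

Definition is_qstar (delta : nat) (q qs : {poly int}) : Prop :=
  0 < lead_coef qs /\
  exists s : {poly int},
    is_squarefree_part (resultant_u delta q) s /\
    (qs \Po 'X^delta = s \/ qs \Po 'X^delta = - s).

(* fs is the polynomial f^* attached to f and delta. *)
Definition is_fstar (delta : nat) (f fs : {poly int}) : Prop :=
  exists (m : nat) (q : 'I_m -> {poly int}) (alpha : 'I_m -> nat)
         (qs : 'I_m -> {poly int}),
    [/\ irreducible_family q alpha /\ (forall j, zcontents (q j) = 1),
        f = \prod_j q j ^+ alpha j,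
        forall j, is_qstar delta (q j) (qs j),
        is_lcmp (fun j => qs j ^+ alpha j) fs &
        0 < lead_coef fs].

Section Roots.
Variable C : numClosedFieldType.

Definition croot (f : {poly int}) (z : C) : bool := root (map_poly intr f) z.

(* C is any model of the complex numbers, e.g. R[i] for R a real closed field,
   or algC; in it, 0 < z means that z is real and positive. *)
Definition pos_exponent (f : {poly int}) (xp : C) (d : nat) : Prop :=
  (1 < d)%N /\
  forall z : C, croot f z -> z != xp -> `|z| = xp -> 0 < z ^+ d.

End Roots.

(* Main.v *)
(** The complex roots of the square-free part of
    R_u(u^delta - x^delta, q(u)) are those z such that z^delta = w^delta for
    some root w of q; since C is closed under delta-th roots, the roots of q^*
    are exactly the delta-th powers of the roots of q. As f^* divides the
    product of the powers (q_j^* )^alpha_j and is divisible by each of them, the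
    roots of f^* are exactly the delta-th powers of the roots of f. A root w of
    f of modulus xp has w^delta real and positive, hence w^delta = xp^delta. *)
Require Import Defs.
From HB Require Import structures.
From mathcomp Require Import all_boot all_order all_algebra.

Set Implicit Arguments.
Unset Strict Implicit.
Unset Printing Implicit Defensive.

Import Order.TTheory GRing.Theory Num.Theory.
Local Open Scope ring_scope.

Section RootsOfFstar.
Variable C : numClosedFieldType.
Implicit Types (f g q s : {poly int}) (y z w : C) (delta : nat).

Lemma crootM f g z : croot (f * g) z = croot f z || croot g z.
Proof. by rewrite /croot rmorphM rootM. Qed.

Lemma crootN f z : croot (- f) z = croot f z.
Proof. by rewrite /croot rmorphN rootN. Qed.

Lemma crootX f z n : (0 < n)%N -> croot (f ^+ n) z = croot f z.
Proof. by move=> n0; rewrite /croot rmorphXn root_exp //; apply: mulrC. Qed.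

Lemma croot_prod (I : finType) (F : I -> {poly int}) z :
  croot (\prod_i F i) z = [exists i, croot (F i) z].
Proof.
rewrite /croot rmorph_prod rootE horner_prod.
by apply/prodf_eq0/existsP => [[i _ Fi]|[i Fi]]; exists i.
Qed.

Lemma croot_prodX (I : finType) (F : I -> {poly int}) (e : I -> nat) z :
  (forall i, (1 <= e i)%N) ->
  croot (\prod_i F i ^+ e i) z = [exists i, croot (F i) z].
Proof.
by move=> e1; rewrite croot_prod; apply: eq_existsb => i; rewrite crootX.
Qed.

Lemma croot_comp_polyXn delta f z :
  croot (f \Po 'X^delta) z = croot f (z ^+ delta).
Proof.
by rewrite /croot map_comp_poly map_polyXn !rootE horner_comp hornerXn.
Qed.

Lemma zdvdp_croot f g z : zdvdp f g -> croot f z -> croot g z.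
Proof. by case=> r -> fz; rewrite crootM fz orbT. Qed.

(** Neither the sign nor exponents that are at least 1 affect the set of roots. *)
Lemma croot_squarefree_part f s z :
  is_squarefree_part f s -> croot s z = croot f z.
Proof.
case=> m [p [e [[_ e1 _ _] fE ->]]].
by case: fE => ->; rewrite ?crootN croot_prodX // croot_prod.
Qed.

(** Specializing x to z turns the resultant into that of u^delta - z^delta and q(u) over C, which
    vanishes exactly when the two have a common root u = w. *)
Lemma croot_resultant_u delta q z : (0 < delta)%N -> q != 0 ->
  croot (resultant_u delta q) z <-> exists2 w, croot q w & w ^+ delta = z ^+ delta.
Proof.
move=> delta0 q0.
pose ev : {rmorphism {poly int} -> C} := horner_eval z \o map_poly intr.
have evC a : ev a%:P = a%:~R by rewrite /ev /= map_polyC /horner_eval hornerC.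
have lead1 : lead_coef ('X^delta - ('X^delta)%:P : {poly {poly int}}) = 1.
  by apply/eqP; rewrite -monicE monicXnsubC.
have leadq : lead_coef (map_poly (@polyC int) q) = (lead_coef q)%:P.
  by rewrite lead_coef_map_inj //; exact: polyC_inj.
have -> : croot (resultant_u delta q) z = (ev (resultant_u delta q) == 0).
  by rewrite /croot rootE.
(* Specialization commutes with the resultant because both leading coefficients in u, namely 1 and
   that of [q], are nonzero constants in x. *)
rewrite /resultant_u map_resultant; first last.
- by rewrite leadq evC intr_eq0 lead_coef_eq0.
- by rewrite lead1 rmorph1 oner_eq0.
have -> : map_poly ev ('X^delta - ('X^delta)%:P) = 'X^delta - (z ^+ delta)%:P.
  rewrite rmorphB /= map_polyXn map_polyC /=.
  by rewrite map_polyXn /horner_eval hornerXn.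
have -> : map_poly ev (map_poly (@polyC int) q) = map_poly intr q.
  by rewrite -map_poly_comp; apply: eq_map_poly => a; exact: evC.
rewrite resultant_eq0.
have rootXn w : root ('X^delta - (z ^+ delta)%:P) w = (w ^+ delta == z ^+ delta).
  by rewrite rootE !hornerE subr_eq0.
have gcd0 : gcdp ('X^delta - (z ^+ delta)%:P) (map_poly intr q) != 0.
  by rewrite gcdp_eq0 negb_and monic_neq0 ?monicXnsubC.
split=> [gcd1|[w qw wz]].
  have /closed_rootP[w] :
      size (gcdp ('X^delta - (z ^+ delta)%:P) (map_poly intr q)) != 1%N.
    by rewrite neq_ltn gcd1 orbT.
  by rewrite root_gcd rootXn => /andP[/eqP wz qw]; exists w.
by apply: (root_size_gt1 (a := w) gcd0); rewrite root_gcd rootXn wz eqxx.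
Qed.

Lemma croot_qstar delta q qs y : (0 < delta)%N -> q != 0 ->
  is_qstar delta q qs ->
  croot qs y <-> exists2 w, croot q w & y = w ^+ delta.
Proof.
move=> delta0 q0 [_ [s [sqf qsE]]].
have pow z : croot qs (z ^+ delta) <->
    exists2 w, croot q w & w ^+ delta = z ^+ delta.
  apply: iff_trans (croot_resultant_u z delta0 q0).
  rewrite -(croot_squarefree_part _ sqf) -croot_comp_polyXn.
  by case: qsE => ->; rewrite ?crootN.
split=> [|[w qw ->]]; last by apply/pow; exists w.
(* Any y is the delta-th power of one of its delta-th roots, so [pow] applies to it. *)
by rewrite -{1}(rootCK delta0 y) => /pow[w qw]; rewrite rootCK //; exists w.
Qed.

Lemma croot_fstar delta f fs y : (0 < delta)%N -> is_fstar delta f fs ->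
  croot fs y <-> exists2 w, croot f w & y = w ^+ delta.
Proof.
move=> delta0 [m [q [alpha [qs [[[_ a1 qirr _] _] -> qsP [fsM fsmin] _]]]]].
have q0 j : q j != 0 by case: (qirr j).
split=> [fsy|[w]].
  (* The product is a common multiple, so [fs] divides it and has no other roots. *)
  have dvd_prod j : zdvdp (qs j ^+ alpha j) (\prod_i qs i ^+ alpha i).
    by rewrite (bigD1 j) //= mulrC; eexists.
  have := zdvdp_croot (fsmin _ dvd_prod) fsy.
  rewrite croot_prodX // => /existsP[j] /(croot_qstar _ delta0 (q0 j) (qsP j)).
  by case=> w qw yw; exists w => //; rewrite croot_prodX //; apply/existsP; exists j.
rewrite croot_prodX // => /existsP[j qw] yw.
apply: zdvdp_croot (fsM j) _; rewrite crootX //.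
by apply/(croot_qstar _ delta0 (q0 j) (qsP j)); exists w.
Qed.

End RootsOfFstar.

Theorem corollary4p11 (C : numClosedFieldType) (f fs : {poly int})
    (xp : C) (delta : nat)
    (f_nonconst : (1 < size f)%N)
    (f_lead : 0 < lead_coef f)
    (f_const : f`_0 != 0)
    (f_prim : zcontents f = 1)
    (xp_unique : unique (fun w : C => croot f w /\ 0 < w) xp)
    (xp_dominant : forall w : C, croot f w -> `|w| <= xp)
    (delta_ok : pos_exponent f xp delta)
    (delta_min : forall d : nat, pos_exponent f xp d -> (delta <= d)%N)
    (fs_star : is_fstar delta f fs) :
  (exists! z : C, croot fs z /\ `|z| = xp ^+ delta) /\
  (forall z : C, croot fs z -> z != xp ^+ delta -> `|z| < xp ^+ delta).
Proof.
have [[fxp xp0] _] := xp_unique; have [delta1 delta_pos] := delta_ok.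
have delta0 : (0 < delta)%N by exact: ltnW.
have fsP y := croot_fstar y delta0 fs_star.
have peripheral z : croot fs z -> `|z| = xp ^+ delta -> z = xp ^+ delta.
  (* If w differs from [xp], then |w|^delta = [xp]^delta gives |w| = [xp], as delta-th powers are
     injective on nonnegative reals; so w^delta is positive and equals its own modulus. *)
  move=> /fsP[w fw ->] nw; have [-> //|w_xp] := eqVneq w xp.
  rewrite -nw gtr0_norm // delta_pos //; apply/eqP.
  by rewrite -(eqrXn2 delta0 (normr_ge0 w) (ltW xp0)) -normrX nw.
split.
  exists (xp ^+ delta); split=> [|z [fz nz]]; last by rewrite (peripheral z).
  by split; [apply/fsP; exists xp | rewrite gtr0_norm // exprn_gt0].
move=> z fz z_xp; rewrite lt_neqAle; apply/andP; split.
  by apply: contra z_xp => /eqP nz; apply/eqP/peripheral.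
have /fsP[w fw ->] := fz.
by rewrite normrX lerXn2r ?nnegrE ?normr_ge0 ?(ltW xp0) ?xp_dominant.
Qed.
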